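(* Let $\mathbb{F}$ be a division ring, $n$ a positive integer, $\sigma:\mathbb{F}\to\mathbb{F}^{n\times n}$ a ring morphism, $\delta:\mathbb{F}\to\mathbb{F}^n$ a $\sigma$-derivation, and $\mathbf{a}\in\mathbb{F}^n$. The following hold. 1. If $\mathcal{G}\subseteq\mathcal{C}(\mathbf{a})$ is finite and $\Omega=\overline{\mathcal{G}}\subseteq\mathbb{F}^n$, then $$\Omega=\{\mathbf{a}^\beta\mid\beta\in\Omega^{\mathcal{D}}\setminus\{0\}\}\subseteq\mathcal{C}(\mathbf{a})\qquad( * )$$ for a finite-dimensional right vector space $\Omega^{\mathcal{D}}\subseteq\mathbb{F}$ over $K_{\mathbf{a}}$. 2. Conversely, if $\Omega^{\mathcal{D}}\subseteq\mathbb{F}$ is a finite-dimensional right vector space over $K_{\mathbf{a}}$, then $\Omega\subseteq\mathcal{C}(\mathbf{a})$ given as in $( * )$ is a finitely generated P-closed set. Moreover, if Item 1 or 2 holds, then $\mathcal{B}^{\mathcal{D}}$ is a right basis of $\Omega^{\mathcal{D}}$ over $K_{\mathbf{a}}$ if, and only if, $\mathcal{B}=\{\mathbf{a}^\beta\mid\beta\in\mathcal{B}^{\mathcal{D}}\}$ is a P-basis of $\Omega$. In particular, $$\mathrm{Rk}(\Omega)=\dim^R_{K_{\mathbf{a}}}(\Omega^{\mathcal{D}}).$$ Thus the map $\Omega\mapsto\Omega^{\mathcal{D}}$ is a bijection between finitely generated P-closed subsets of $\mathcal{C}(\mathbf{a})$ and finite-dimensional right vector subspaces of $\mathbb{F}$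 over $K_{\mathbf{a}}$.
   Context: Rings are associative with identity, not necessarily commutative, and ring morphisms preserve identities. $\mathbb{F}^*=\mathbb{F}\setminus\{0\}$ and $\mathbb{F}^n$ denotes column vectors. A map $\delta:\mathbb{F}\to\mathbb{F}^n$ is a $\sigma$-derivation if $\delta(a+b)=\delta(a)+\delta(b)$ and $\delta(ab)=\sigma(a)\delta(b)+\delta(a)b$ for all $a,b\in\mathbb{F}$. Free skew polynomial ring: let $\mathcal{M}$ be the free monoid on pairwise distinct variables $x_1,\dots,x_n$. $\mathbb{F}[\mathbf{x};\sigma,\delta]$ is the left $\mathbb{F}$-vector space with basis $\mathcal{M}$, with the ring product given by concatenating monomials and $x_i a=\sum_{j=1}^n\sigma_{i,j}(a)x_j+\delta_i(a)$ for $a\in\mathbb{F}$, where $\sigma_{i,j}$ and $\delta_i$ are the components of $\sigma$ and $\delta$. Its elements are called skew polynomials. Skew evaluation: for $\mathbf{a}=(a_1,\dots,a_n)\in\mathbb{F}^n$ and a skew polynomial $F$, $F(\mathbf{a})$ is the unique element of $\mathbb{F}$ such that $F-F(\mathbf{a})$ belongs to the left ideal generated by $x_1-a_1,\dots,x_n-a_n$. Conjugacy and centralizers: $\mathcal{D}_{\mathbf{a}}(\beta)=\sigma(\beta)\mathbf{a}+\delta(\beta)\in\mathbb{F}^n$ for $\beta\in\mathbb{F}$; $\mathbf{a}^\beta=\mathcal{D}_{\mathbf{a}}(\beta)\beta^{-1}$ for $\beta\in\mathbb{F}^*$; $\mathcal{C}(\mathbf{a})=\{\mathbf{a}^\beta\mid\beta\in\mathbb{F}^*\}$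 is the conjugacy class of $\mathbf{a}$ (conjugacy is an equivalence relation on $\mathbb{F}^n$); $K_{\mathbf{a}}=\{\beta\in\mathbb{F}\mid\mathcal{D}_{\mathbf{a}}(\beta)=\mathbf{a}\beta\}$ is the centralizer of $\mathbf{a}$, a division subring of $\mathbb{F}$. $\dim^R_K$ denotes right dimension over $K$. P-closed sets: for $\Omega\subseteq\mathbb{F}^n$, $I(\Omega)=\{F\in\mathbb{F}[\mathbf{x};\sigma,\delta]\mid F(\mathbf{a})=0\ \forall\mathbf{a}\in\Omega\}$; for a set $\mathcal{A}$ of skew polynomials, $Z(\mathcal{A})=\{\mathbf{a}\in\mathbb{F}^n\mid F(\mathbf{a})=0\ \forall F\in\mathcal{A}\}$. The P-closure is $\overline{\Omega}=Z(I(\Omega))$, and $\Omega$ is P-closed if $\overline{\Omega}=\Omega$. A P-closed $\Omega$ is generated by $\mathcal{G}\subseteq\Omega$ if $\overline{\mathcal{G}}=\Omega$, and is finitely generated if some finite $\mathcal{G}$ generates it. A set $\Omega$ is P-independent if $\mathbf{a}\notin\overline{\Omega\setminus\{\mathbf{a}\}}$ for all $\mathbf{a}\in\Omega$. A P-basis of a P-closed set is a P-independent generating subset. All P-bases of a finitely generated P-closed set $\Omega$ are finite of the same size, which is called its rank $\mathrm{Rk}(\Omega)$.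
   Formalization: In the ''if and only if'', B^D is assumed not to contain 0, and the right side also requires that β ↦ a^β be injective on B^D; otherwise B^D = {β, βk} with k in K_a, k ≠ 0, 1, gives a P-basis {a^β} although B^D is not a right basis. *)

(* Defs.v *)
From HB Require Import structures.
From mathcomp Require Import all_boot all_algebra finmap.
From mathcomp Require Import boolp classical_sets functions cardinality.
From mathcomp.multinomials Require Import monalg.

Set Implicit Arguments.
Unset Strict Implicit.
Unset Printing Implicit Defensive.

Import GRing.Theory.
Local Open Scope ring_scope.
Local Open Scope card_scope.

(* Right multiplication of a column vector by a scalar; [*:] would multiply on
   the left, which is different since the ring is not commutative. *)
Definition rscale (F : nzRingType) n (v : 'cV[F]_n) (b : F) : 'cV[F]_n :=
  v *m b%:M.

Lemma rscaleE (F : nzRingType) n (v : 'cV[F]_n) (b : F) i :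
  rscale v b i 0 = v i 0 * b.
Proof. by rewrite /rscale mxE big_ord1 mxE eqxx mulr1n. Qed.

Record skew_derivation (F : nzRingType) n (sigma : {rmorphism F -> 'M[F]_n}) :=
  SkewDerivation {
    skew_der :> F -> 'cV[F]_n;
    skew_derD : forall x y, skew_der (x + y) = skew_der x + skew_der y;
    skew_derM : forall x y,
      skew_der (x * y) = sigma x *m skew_der y + rscale (skew_der x) y
  }.

Section MonomialSums.
Variables (K : choiceType) (F : nzRingType) (W : zmodType) (h : K -> F -> W).
Hypothesis hD : forall m x y, h m (x + y) = h m x + h m y.

Definition msum (P : {malg F[K]}) : W := \sum_(m <- msupp P) h m P@_m.

Lemma msum_coef0 m : h m 0 = 0.
Proof. by apply: (addIr (h m 0)); rewrite -hD !add0r. Qed.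

Lemma msumEw (d : {fset K}) P : (msupp P `<=` d)%fset ->
  msum P = \sum_(m <- d) h m P@_m.
Proof.
move=> le; rewrite /msum (big_fset_incl _ le) //= => m _ /mcoeff_outdom ->.
exact: msum_coef0.
Qed.

Lemma msumD P Q : msum (P + Q) = msum P + msum Q.
Proof.
rewrite (msumEw (msuppD_le P Q)) (msumEw (fsubsetUl (msupp P) (msupp Q))).
rewrite (msumEw (fsubsetUr (msupp P) (msupp Q))) -big_split /=.
by apply: eq_bigr => m _; rewrite mcoeffD hD.
Qed.

Lemma msum0 : msum 0 = 0.
Proof. by rewrite /msum msupp0 big_seq_fset0. Qed.

Lemma msumU c m : msum << c *g m >> = h m c.
Proof. by rewrite (msumEw msuppU_le) big_seq_fset1 mcoeffUU. Qed.

End MonomialSums.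

Lemma malg_ind (K : choiceType) (F : nzRingType) (p : {malg F[K]} -> Prop) :
  (forall P Q, p P -> p Q -> p (P + Q)) -> p 0 ->
  (forall c m, p << c *g m >>) -> forall P, p P.
Proof. by move=> pD p0 pU P; rewrite [P]monalgE; apply: big_ind. Qed.

(* A word [:: i1; ...; ik] stands for the monomial x_i1 ... x_ik. *)
Section Product.
Variables (F : nzRingType) (n : nat) (sigma : {rmorphism F -> 'M[F]_n}).
Variable delta : skew_derivation sigma.
Local Notation V := {malg F[seq 'I_n]}.

(* x_i * (c m) = \sum_j sigma_ij(c) (x_j m) + delta_i(c) m, for a word m. *)
Definition xmul_mon (i : 'I_n) (m : seq 'I_n) (c : F) : V :=
  \sum_j << sigma c i j *g j :: m >> + << delta c i 0 *g m >>.

Definition xmul (i : 'I_n) : V -> V := msum (xmul_mon i).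

(* The value at P of the extension to skew polynomials of an action X of the
   variables on a left F-module W. *)
Definition skact (W : lmodType F) (X : 'I_n -> W -> W) (P : V) (w : W) : W :=
  msum (fun m c => c *: foldr X w m) P.

Definition skmul (P Q : V) : V := skact xmul P Q.
Definition skone : V := << 1 *g [::] >>.

Lemma delta0 : delta 0 = 0.
Proof. by apply: (addIr (delta 0)); rewrite -skew_derD !add0r. Qed.

Lemma delta1 : delta 1 = 0.
Proof.
have := skew_derM delta 1 1.
rewrite mulr1 rmorph1 mul1mx /rscale mulmx1 => /esym.
by rewrite -[RHS]add0r => /addIr.
Qed.

Lemma xmul_monD i m x y : xmul_mon i m (x + y) = xmul_mon i m x + xmul_mon i m y.
Proof.
rewrite /xmul_mon skew_derD rmorphD /= addrACA -big_split /= mxE raddfD.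
by congr (_ + _); apply: eq_bigr => j _; rewrite mxE raddfD.
Qed.

Lemma xmulU i c m : xmul i << c *g m >> = xmul_mon i m c.
Proof. exact: (msumU (@xmul_monD i)). Qed.

Lemma xmulD i P Q : xmul i (P + Q) = xmul i P + xmul i Q.
Proof. exact: (msumD (@xmul_monD i)). Qed.

Lemma xmul_comm i c P :
  xmul i (c *: P) = \sum_j sigma c i j *: xmul j P + delta c i 0 *: P.
Proof.
elim/malg_ind: P => [P Q hP hQ||x m].
- rewrite (scalerDr c P Q) (scalerDr (delta c i 0) P Q) xmulD hP hQ addrACA.
  congr (_ + _); rewrite -big_split /=; apply: eq_bigr => j _.
  by rewrite xmulD (scalerDr (sigma c i j)).
- by rewrite !scaler0 addr0 /xmul msum0 big1 // => j _; rewrite msum0 scaler0.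
- have scU (b d : F) (k : seq 'I_n) : b *: << d *g k >> = << b * d *g k >>.
    by apply/malgP => k'; rewrite mcoeffZ !mcoeffU mulrnAr.
  rewrite scU xmulU /xmul_mon skew_derM rmorphM !mxE big_ord1 !mxE eqxx mulr1n.
  rewrite scU raddfD addrA; congr (_ + _).
  transitivity (\sum_j (sigma c i j *:
     (\sum_k << sigma x j k *g k :: m >> + << delta x j 0 *g m >>)));
    last by apply: eq_bigr => j _; rewrite xmulU.
  under [RHS]eq_bigr do rewrite scalerDr scU.
  rewrite big_split /= raddf_sum; congr (_ + _).
  under [RHS]eq_bigr do rewrite scaler_sumr.
  rewrite exchange_big /=; apply: eq_bigr => k _.
  by rewrite mxE raddf_sum; apply: eq_bigr => j _; rewrite scU.
Qed.

Section Action.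
Variables (W : lmodType F) (X : 'I_n -> W -> W).
Hypothesis XD : forall i v w, X i (v + w) = X i v + X i w.
Hypothesis XZ : forall i c w,
  X i (c *: w) = \sum_j sigma c i j *: X j w + delta c i 0 *: w.

Lemma skact_coefD w (m : seq 'I_n) x y :
  (x + y) *: foldr X w m = x *: foldr X w m + y *: foldr X w m.
Proof. exact: scalerDl. Qed.

Lemma skactD P Q w : skact X (P + Q) w = skact X P w + skact X Q w.
Proof. exact: (msumD (@skact_coefD w)). Qed.

Lemma skactU c m w : skact X << c *g m >> w = c *: foldr X w m.
Proof. exact: (msumU (@skact_coefD w)). Qed.

Lemma skact0 w : skact X 0 w = 0.
Proof. exact: msum0. Qed.

Lemma foldrXD m v w : foldr X (v + w) m = foldr X v m + foldr X w m.
Proof. by elim: m => //= i m ->. Qed.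

Lemma skactDr P v w : skact X P (v + w) = skact X P v + skact X P w.
Proof.
rewrite /skact /msum -big_split /=.
by apply: eq_bigr => m _; rewrite foldrXD scalerDr.
Qed.

Lemma skactZ c P w : skact X (c *: P) w = c *: skact X P w.
Proof.
elim/malg_ind: P => [P Q hP hQ||x m].
- by rewrite scalerDr !skactD hP hQ scalerDr.
- by rewrite scaler0 skact0 scaler0.
- have -> : c *: << x *g m >> = << c * x *g m >>.
    by apply/malgP => k'; rewrite mcoeffZ !mcoeffU mulrnAr.
  by rewrite !skactU scalerA.
Qed.

Lemma skact_sum I (r : seq I) (G : I -> V) w :
  skact X (\sum_(i <- r) G i) w = \sum_(i <- r) skact X (G i) w.
Proof. by elim/big_rec2: _ => [|i u v _ <-]; rewrite ?skact0 ?skactD. Qed.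

Lemma skact_xmul i P w : skact X (xmul i P) w = X i (skact X P w).
Proof.
have X0 j : X j 0 = 0 by apply: (addIr (X j 0)); rewrite -XD !add0r.
elim/malg_ind: P => [P Q hP hQ||x m].
- by rewrite xmulD !skactD hP hQ XD.
- by rewrite /xmul msum0 skact0 X0.
- rewrite xmulU /xmul_mon skactD skact_sum !skactU XZ; congr (_ + _).
  by apply: eq_bigr => j _; rewrite skactU.
Qed.

Lemma skactM P Q w : skact X (skmul P Q) w = skact X P (skact X Q w).
Proof.
have -> : skmul P Q = \sum_(m <- msupp P) P@_m *: foldr xmul Q m by [].
rewrite skact_sum; apply: eq_bigr => m _.
rewrite skactZ; congr (_ *: _).
by elim: m => //= i m <-; rewrite skact_xmul.
Qed.

End Action.

Lemma skmulA : associative skmul.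
Proof. by move=> P Q R; rewrite /skmul (skactM xmulD xmul_comm). Qed.

Lemma skmul1l : left_id skone skmul.
Proof. by move=> P; rewrite /skmul /skone skactU scale1r. Qed.

Lemma skmul1r : right_id skone skmul.
Proof.
have foldr1 (m : seq 'I_n) : foldr xmul skone m = << 1 *g m >>.
  elim: m => //= i m ->; rewrite xmulU /xmul_mon delta1 rmorph1 mxE raddf0 addr0.
  rewrite (bigD1 i) //= mxE eqxx mulr1n big1 ?addr0 // => j /negPf.
  by rewrite eq_sym mxE => ->; rewrite raddf0.
move=> P; rewrite /skmul; elim/malg_ind: P => [P Q hP hQ||x m].
- by rewrite skactD hP hQ.
- by rewrite skact0.
- rewrite skactU foldr1; apply/malgP => k'.
  by rewrite mcoeffZ !mcoeffU mulrnAr mulr1.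
Qed.

Lemma skmulDl : left_distributive skmul +%R.
Proof. by move=> P Q R; exact: skactD. Qed.

Lemma skmulDr : right_distributive skmul +%R.
Proof. by move=> P Q R; exact: (skactDr xmulD). Qed.

Lemma skone_neq0 : skone != 0.
Proof. by rewrite monalgU_eq0 oner_eq0. Qed.

End Product.

Definition skpoly F n sigma (delta : @skew_derivation F n sigma) : Type :=
  {malg F[seq 'I_n]}.

HB.instance Definition _ F n sigma (delta : @skew_derivation F n sigma) :=
  GRing.Lmodule.on (skpoly delta).
HB.instance Definition _ F n sigma (delta : @skew_derivation F n sigma) :=
  GRing.Zmodule_isNzRing.Build (skpoly delta)
    (skmulA delta) (@skmul1l _ _ _ delta) (@skmul1r _ _ _ delta)
    (@skmulDl _ _ _ delta) (@skmulDr _ _ _ delta) (skone_neq0 F n).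

Section SkewPolynomials.
Variables (F : nzRingType) (n : nat) (sigma : {rmorphism F -> 'M[F]_n}).
Variable delta : skew_derivation sigma.

Definition skpolyC (c : F) : skpoly delta := << c *g [::] >>.
Definition skpolyX (i : 'I_n) : skpoly delta := << 1 *g [:: i] >>.

Lemma mul_skpolyC c (P : skpoly delta) : skpolyC c * P = c *: P.
Proof. exact: skactU. Qed.

Lemma skpoly_monE (m : seq 'I_n) :
  \prod_(i <- m) skpolyX i = << 1 *g m >> :> skpoly delta.
Proof.
elim: m => [|i m IHm]; first by rewrite big_nil.
rewrite big_cons IHm -[RHS](skmul1r delta) -[in LHS](skmul1r delta << 1 *g m >>).
by rewrite /GRing.mul /= /skmul !skactU /= !scale1r.
Qed.

Lemma skpolyXC i c :
  skpolyX i * skpolyC c =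
    \sum_j skpolyC (sigma c i j) * skpolyX j + skpolyC (delta c i 0).
Proof.
rewrite {1}/GRing.mul /= /skmul skactU /= scale1r xmulU; congr (_ + _).
apply: eq_bigr => j _; rewrite mul_skpolyC; apply/malgP => k'.
by rewrite mcoeffZ !mcoeffU mulrnAr mulr1.
Qed.

Definition in_left_ideal (I : finType) (g : I -> skpoly delta)
    (P : skpoly delta) : Prop :=
  exists q : I -> skpoly delta, P = \sum_i q i * g i.

Definition is_skeval (P : skpoly delta) (a : 'cV[F]_n) (c : F) : Prop :=
  in_left_ideal (fun i => skpolyX i - skpolyC (a i 0)) (P - skpolyC c).

Definition skeval (P : skpoly delta) (a : 'cV[F]_n) : F :=
  xget 0 [set c | is_skeval P a c].

Definition Dmap (a : 'cV[F]_n) (b : F) : 'cV[F]_n := sigma b *m a + delta b.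

Lemma is_skeval_ex P a : exists c, is_skeval P a c.
Proof.
pose g i := skpolyX i - skpolyC (a i 0).
have JD P1 P2 : in_left_ideal g P1 -> in_left_ideal g P2 ->
    in_left_ideal g (P1 + P2).
  move=> [q1 ->] [q2 ->]; exists (fun i => q1 i + q2 i).
  by rewrite -big_split; apply: eq_bigr => i _; rewrite mulrDl.
have JM Q P1 : in_left_ideal g P1 -> in_left_ideal g (Q * P1).
  move=> [q ->]; exists (fun i => Q * q i).
  by rewrite mulr_sumr; apply: eq_bigr => i _; rewrite mulrA.
have CD x y : skpolyC (x + y) = skpolyC x + skpolyC y by exact: raddfD.
have CZ x y : x *: skpolyC y = skpolyC (x * y).
  by apply/malgP => k'; rewrite mcoeffZ !mcoeffU mulrnAr.
have J0 : in_left_ideal g 0.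
  by exists (fun=> 0); rewrite big1 // => i _; rewrite mul0r.
have evD P1 P2 c1 c2 : is_skeval P1 a c1 -> is_skeval P2 a c2 ->
    is_skeval (P1 + P2) a (c1 + c2).
  by move=> h1 h2; rewrite /is_skeval CD opprD addrACA; apply: JD.
elim/malg_ind: P => [P Q [c hc] [d hd]||x m].
- by exists (c + d); apply: evD.
- by exists 0; rewrite /is_skeval /skpolyC raddf0 subr0.
suff [c hc] : exists c, is_skeval << 1 *g m >> a c.
  exists (x * c); rewrite /is_skeval -CZ.
  have -> : (<< x *g m >> : skpoly delta) = x *: << 1 *g m >>.
    by apply/malgP => k'; rewrite mcoeffZ !mcoeffU mulrnAr mulr1.
  by rewrite -scalerBr -mul_skpolyC; apply: JM.
elim: m => [|i m [c hc]].
  by exists 1; rewrite /is_skeval /skpolyC subrr.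
rewrite -skpoly_monE big_cons skpoly_monE.
exists (Dmap a c i 0).
rewrite /is_skeval -[X in skpolyX i * X](subrK (skpolyC c)) mulrDr -addrA.
apply: JD; first exact: JM.
rewrite skpolyXC mxE mxE CD opprD addrACA subrr addr0.
exists (fun j => skpolyC (sigma c i j)).
under [RHS]eq_bigr do rewrite mulrBr [_ * skpolyC (a _ _)]mul_skpolyC CZ.
by rewrite sumrB; congr (_ - _); rewrite /skpolyC raddf_sum.
Qed.

Lemma is_skeval_uniq P a c d : is_skeval P a c -> is_skeval P a d -> c = d.
Proof.
pose X i (b : F^o) : F^o := Dmap a b i 0.
have XD i v w : X i (v + w) = X i v + X i w.
  by rewrite /X /Dmap rmorphD skew_derD mulmxDl addrACA mxE.
have XZ i x w : X i (x *: w) = \sum_j sigma x i j *: X j w + delta x i 0 *: w.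
  rewrite /X /Dmap rmorphM skew_derM -mulmxA addrA -mulmxDr.
  rewrite mxE rscaleE mxE; congr (_ + _).
have JE Q : in_left_ideal (fun i => skpolyX i - skpolyC (a i 0)) Q ->
    skact X Q 1 = 0.
  move=> [q ->]; rewrite skact_sum big1 // => i _.
  rewrite (skactM XD XZ) skactD -scaleN1r skactZ !skactU /= scale1r.
  rewrite /X /Dmap rmorph1 mul1mx delta1 addr0.
  rewrite scaleN1r -[a i 0 *: 1]/(a i 0 * 1) mulr1 subrr.
  by apply: (addIr (skact X (q i) 0)); rewrite -(skactDr XD) !add0r.
move=> /JE + /JE.
have E x : skact X (P - skpolyC x) 1 = skact X P 1 - x.
  rewrite skactD -scaleN1r skactZ skactU scaleN1r.
  by rewrite -[x *: _]/(x * 1) mulr1.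
by rewrite !E => /subr0_eq <- /subr0_eq.
Qed.

Lemma skevalP P a c : is_skeval P a c <-> skeval P a = c.
Proof.
split=> [h|<-]; last by have [d] := is_skeval_ex P a; apply: xgetI.
by apply: xget_unique => // d /is_skeval_uniq; apply.
Qed.

Local Open Scope classical_set_scope.

Definition Pideal (Omega : set 'cV[F]_n) : set (skpoly delta) :=
  [set P | forall a, Omega a -> skeval P a = 0].

Definition Pzeros (A : set (skpoly delta)) : set 'cV[F]_n :=
  [set a | forall P, A P -> skeval P a = 0].

Definition Pclosure (Omega : set 'cV[F]_n) : set 'cV[F]_n :=
  Pzeros (Pideal Omega).

Definition Pclosed (Omega : set 'cV[F]_n) : Prop := Pclosure Omega = Omega.

Definition Pgenerated (Omega G : set 'cV[F]_n) : Prop :=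
  G `<=` Omega /\ Pclosure G = Omega.

Definition Pfingen (Omega : set 'cV[F]_n) : Prop :=
  exists2 G, finite_set G & Pgenerated Omega G.

Definition Pindependent (Omega : set 'cV[F]_n) : Prop :=
  forall a, Omega a -> ~ Pclosure (Omega `\ a) a.

Definition Pbasis (Omega B : set 'cV[F]_n) : Prop :=
  Pindependent B /\ Pgenerated Omega B.

(* The common size of the P-bases; 0 by convention if no P-basis is finite. *)
Definition Prank (Omega : set 'cV[F]_n) : nat :=
  xget 0%N [set d | exists2 B, Pbasis Omega B & B #= `I_d].

Definition centralizer (a : 'cV[F]_n) : set F :=
  [set b | Dmap a b = rscale a b].

End SkewPolynomials.

Section Conjugacy.
Variables (F : unitRingType) (n : nat) (sigma : {rmorphism F -> 'M[F]_n}).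
Variables (delta : skew_derivation sigma) (a : 'cV[F]_n).
Local Open Scope classical_set_scope.

(* Meaningful for b invertible only: b^-1 = b otherwise. *)
Definition conjv (b : F) : 'cV[F]_n := rscale (Dmap delta a b) b^-1.

Definition conj_image (V : set F) : set 'cV[F]_n := [set conjv b | b in V `\ 0].

Definition conj_class : set 'cV[F]_n := conj_image setT.

End Conjugacy.

(* Right linear algebra inside F over a subset K of F, meant to be a division
   subring. *)
Section RightSpaces.
Variables (F : nzRingType) (K : set F).
Local Open Scope classical_set_scope.

Definition right_subspace (V : set F) : Prop :=
  [/\ V 0, forall u v, V u -> V v -> V (u + v)
    & forall u k, V u -> K k -> V (u * k)].

Definition right_free (B : set F) : Prop :=
  forall (s : seq F) (k : F -> F), uniq s ->
    (forall b, b \in s -> B b) -> (forall b, b \in s -> K (k b)) ->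
    \sum_(b <- s) b * k b = 0 -> forall b, b \in s -> k b = 0.

Definition right_span (B : set F) : set F :=
  [set v | exists (s : seq F) (k : F -> F),
    [/\ forall b, b \in s -> B b, forall b, b \in s -> K (k b)
      & v = \sum_(b <- s) b * k b]].

Definition right_basis (V B : set F) : Prop :=
  [/\ B `<=` V, right_free B & right_span B = V].

Definition right_findim (V : set F) : Prop :=
  right_subspace V /\ exists2 B, finite_set B & right_basis V B.

(* The common size of the bases; 0 by convention if no basis is finite. *)
Definition right_dim (V : set F) : nat :=
  xget 0%N [set d | exists2 B, right_basis V B & B #= `I_d].

End RightSpaces.

(* Main.v *)
(** Let F[x] act on F with x_i acting as the i-th component of D_a.
    Evaluation at a is the action on 1, the endomorphisms of this simple module
    are the right multiplications by K_a, and P(a^b) b = P . b. Hence P vanishes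
    on {a^b | b in B} if and only if it annihilates B, and Jacobson's density
    theorem identifies the P-closure of {a^b | b in B}, for finite B, with
    {a^b | b in span(B), b <> 0}. Points outside the conjugacy class of a give
    non-isomorphic simple modules, so they are excluded by the same argument
    carried out for the two modules at once. P-independence and generation thus
    translate into linear independence and generation over K_a. *)

Require Import Defs.
From mathcomp Require Import all_boot all_algebra.
From mathcomp Require Import boolp classical_sets functions cardinality.

Set Implicit Arguments.
Unset Strict Implicit.
Unset Printing Implicit Defensive.

Import GRing.Theory.
Local Open Scope ring_scope.
Local Open Scope classical_set_scope.

(** * Right linear algebra over a division subring *)

Section RightSpanTheory.
Variables (F : unitRingType) (K : set F).

(** Coefficients are peeled off one at a time to suit induction on [s], and copies of the same
    vector may receive different ones. [K] is an arbitrary set because the density argument takes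
    its coefficients among intertwiners between two points, which need not form a ring. *)
Fixpoint comb (s : seq F) (v : F) : Prop :=
  if s is b :: s' then exists2 k, K k & comb s' (v - b * k) else v = 0.

Lemma combE s v : uniq s -> comb s v <->
  exists2 k, (forall b, b \in s -> K (k b)) & v = \sum_(b <- s) b * k b.
Proof.
elim: s v => [|b s IHs] v /=.
  by split=> [->|[k _]]; [exists id; rewrite ?big_nil | rewrite big_nil].
move=> /andP[bs us]; split=> [[c Kc /(IHs _ us)[k Kk e]]|[k Kk]].
  exists (fun x => if x == b then c else k x) => [x|].
    by rewrite inE; case: eqP => //= _; apply: Kk.
  rewrite big_cons eqxx -[LHS](subrKC (b * c)) e; congr (_ + _).
  apply: eq_big_seq => x xs; case: eqP => // xb.
  by rewrite -xb xs in bs.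
rewrite big_cons => ->; exists (k b); first by apply: Kk; rewrite mem_head.
apply/(IHs _ us); exists k; first by move=> x xs; apply: Kk; rewrite inE xs orbT.
by rewrite addrC addKr.
Qed.

Definition division_subring : Prop :=
  [/\ K 1, forall x y, K x -> K y -> K (x - y),
      forall x y, K x -> K y -> K (x * y) & forall x, K x -> K x^-1].

Hypothesis divF : forall x : F, x != 0 -> x \is a GRing.unit.
Hypothesis KP : division_subring.

Let K1 : K 1. Proof. by case: KP. Qed.
Let KB x y : K x -> K y -> K (x - y). Proof. by case: KP => _ + _ _; apply. Qed.
Let KM x y : K x -> K y -> K (x * y). Proof. by case: KP => _ _ + _; apply. Qed.
Let KV x : K x -> K x^-1. Proof. by case: KP => _ _ _; apply. Qed.
Let K0 : K 0. Proof. by rewrite -(subrr 1); apply: KB. Qed.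
Let KN x : K x -> K (- x). Proof. by rewrite -sub0r; apply: KB. Qed.
Let KD x y : K x -> K y -> K (x + y).
Proof. by move=> Kx Ky; rewrite -[y]opprK; apply: KB => //; apply: KN. Qed.

Lemma comb_subspace s : right_subspace K (comb s).
Proof.
elim: s => [|b s [s0 sD sM]]; split=> /=.
- by [].
- by move=> u v -> ->; rewrite addr0.
- by move=> u k -> _; rewrite mul0r.
- by exists 0; rewrite // mulr0 subr0.
- move=> u v [k Kk hu] [l Kl hv]; exists (k + l); first exact: KD.
  by rewrite mulrDr opprD addrACA; apply: sD.
- move=> u k [l Kl hu] Kk; exists (l * k); first exact: KM.
  by rewrite mulrA -mulrBl; apply: sM.
Qed.

Lemma comb_sub (V : set F) s : right_subspace K V -> [set` s] `<=` V ->
  comb s `<=` V.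
Proof.
move=> [V0 VD VM]; elim: s => [_ v /= -> //|b s IHs sV v [k Kk hv]].
rewrite -(subrKC (b * k) v); apply: VD.
  by apply: VM => //; apply: sV; rewrite /= mem_head.
by apply: IHs hv => x /= xs; apply: sV; rewrite /= inE xs orbT.
Qed.

Lemma sub_comb s : [set` s] `<=` comb s.
Proof.
elim: s => // b s IHs x /=; rewrite inE => /orP[/eqP->|xs].
  by exists 1; rewrite // mulr1 subrr; case: (comb_subspace s).
by exists 0; rewrite // mulr0 subr0; apply: IHs.
Qed.

Lemma combS s t : {subset s <= t} -> comb s `<=` comb t.
Proof.
move=> st v; apply: comb_sub; first exact: comb_subspace.
by move=> x /= /st; apply: sub_comb.
Qed.

Lemma right_spanP (B : set F) v :
  right_span K B v <-> exists2 s, [set` s] `<=` B & comb s v.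
Proof.
split=> [[s [k [sB Kk ->]]]|[s sB hs]].
  exists s => //; elim: s {sB} Kk => [|b s IHs] Kk; rewrite ?big_nil // big_cons.
  exists (k b); first by apply: Kk; rewrite mem_head.
  rewrite addrC addKr; apply: IHs => x xs.
  by apply: Kk; rewrite inE xs orbT.
(* In [right_span] the coefficients are a function of the vector, so copies of a vector must first
   be merged. *)
have hu : comb (undup s) v by apply: combS hs => x; rewrite mem_undup.
have /(combE _ (undup_uniq s))[k Kk ->] := hu.
by exists (undup s), k; split=> // b; rewrite mem_undup; apply: sB.
Qed.

Lemma right_span_subspace (B : set F) : right_subspace K (right_span K B).
Proof.
split=> [|u v /right_spanP[s sB hs] /right_spanP[t tB ht]|].
- by apply/right_spanP; exists [::].
- apply/right_spanP; exists (s ++ t).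
    by move=> x /=; rewrite mem_cat => /orP[/sB|/tB].
  have [_ hD _] := comb_subspace (s ++ t); apply: hD.
    by apply: combS hs => x xs; rewrite mem_cat xs.
  by apply: combS ht => x xt; rewrite mem_cat xt orbT.
- move=> u k /right_spanP[s sB hs] Kk; apply/right_spanP; exists s => //.
  by case: (comb_subspace s) => _ _; apply.
Qed.

Lemma right_span_sub (V B : set F) : right_subspace K V -> B `<=` V ->
  right_span K B `<=` V.
Proof.
move=> hV BV v /right_spanP[s sB]; apply: comb_sub => //.
exact: subset_trans BV.
Qed.

Lemma sub_right_span (B : set F) : B `<=` right_span K B.
Proof.
move=> b Bb; apply/right_spanP; exists [:: b].
  by move=> x /=; rewrite inE => /eqP->.
by apply: sub_comb; rewrite /= mem_head.
Qed.

Lemma right_spanS (B C : set F) : B `<=` C -> right_span K B `<=` right_span K C.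
Proof.
move=> BC; apply: right_span_sub; first exact: right_span_subspace.
exact: subset_trans (@sub_right_span C).
Qed.

Lemma right_span_comb s : right_span K [set` s] = comb s.
Proof.
apply/seteqP; split; last by move=> v hv; apply/right_spanP; exists s.
by apply: right_span_sub; [exact: comb_subspace | exact: sub_comb].
Qed.

Lemma right_freeP (B : set F) :
  right_free K B <-> forall b, B b -> ~ right_span K (B `\ b) b.
Proof.
split=> [freeB b Bb /right_spanP[s sB hs]|indB s k us sB Kk e b bs].
  have us := undup_uniq s.
  have bs : b \notin undup s by rewrite mem_undup; apply/negP => /sB[_ /=].
  have /(combE _ us)[k Kk eb] : comb (undup s) b.
    by apply: combS hs => x; rewrite mem_undup.
  (* Moving [b] to the other side of its expression over [undup s] gives a relation with coefficient
     -1 at [b]. *)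
  have : (if b == b then -1 else k b) = 0.
    apply: (freeB (b :: undup s) (fun x => if x == b then -1 else k x)).
    - by rewrite /= bs.
    - by move=> x; rewrite inE mem_undup => /orP[/eqP->//|/sB[]].
    - move=> x; rewrite inE; case: eqP => [_ _|_ /Kk//]; exact: KN.
    - rewrite big_cons eqxx mulrN1 {1}eb addrC; apply/eqP; rewrite subr_eq0.
      apply/eqP/eq_big_seq => x xs; case: eqP => // xb.
      by rewrite -xb xs in bs.
    - exact: mem_head.
  by move/eqP; rewrite eqxx oppr_eq0 oner_eq0.
apply: contrapT => /eqP kb0; apply: (indB b (sB b bs)).
have Kkb := Kk b bs.
(* The nonzero coefficient [k b] is invertible, so the relation can be solved for [b]. *)
have eb : b = \sum_(x <- rem b s) x * - k x * (k b)^-1.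
  rewrite -mulr_suml; apply: canRL (mulrK (divF kb0)) _.
  under eq_bigr do rewrite mulrN.
  rewrite sumrN; apply/eqP; rewrite -addr_eq0; apply/eqP.
  by rewrite -[RHS]e [RHS](big_rem b bs).
exists (rem b s), (fun x => - k x * (k b)^-1); split.
- move=> x; rewrite mem_rem_uniq // inE => /andP[xb /sB Bx]; split=> //.
  by move=> /= exb; rewrite exb eqxx in xb.
- move=> x /mem_rem xs; apply: KM; last exact: KV.
  by apply/KN/Kk.
- by rewrite [LHS]eb; apply: eq_bigr => x _; rewrite mulrA.
Qed.

(** Vectors in the span of the others are discarded until the remaining list is free, by induction
    on its length. *)
Lemma right_span_basis (B : set F) : finite_set B ->
  exists2 C, finite_set C & right_basis K (right_span K B) C.
Proof.
move=> /finite_seqP[s ->] {B}.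
have [n] := ubnP (size s); elim: n s => // n IHn s ltsn.
case: (pselect (right_free K [set` s])) => [frs|/right_freeP].
  by exists [set` s]; [exact: finite_seq | split; [exact: sub_right_span | |]].
move=> /existsNP[b /not_implyP[/= bs /contrapT hb]].
(* Filtering deletes all copies of [b], as the set difference does. *)
pose t := [seq x <- s | x != b].
have tE : [set` t] = [set` s] `\ b.
  apply/seteqP; split=> x /=; rewrite mem_filter; first by move=> /andP[/eqP ? ?].
  by case=> xs /eqP ->.
have [|C finC basC] := IHn t.
  rewrite -ltnS (leq_trans _ ltsn) // ltnS size_filter -(count_predC (pred1 b) s).
  by rewrite -[X in (X < _)%N]add0n ltn_add2r -has_count has_pred1.
exists C => //; suff <- : right_span K [set` t] = right_span K [set` s] by [].
rewrite tE; apply/seteqP; split; first by apply: right_spanS => x [].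
apply: right_span_sub; first exact: right_span_subspace.
move=> x /= xs; have [->|xb] := eqVneq x b; first exact: hb.
by apply: sub_right_span; split=> //; apply/eqP.
Qed.

Lemma right_findim_span (B : set F) : finite_set B ->
  right_findim K (right_span K B).
Proof. by split; [exact: right_span_subspace | exact: right_span_basis]. Qed.

(** Elimination of the head [b]: the part of [W] inside [comb s] is generated by induction, and one
    vector [w] of [W] with nonzero coefficient at [b] generates the rest. *)
Lemma comb_subspace_generated s (W : set F) : right_subspace K W ->
  W `<=` comb s -> exists2 t, [set` t] `<=` W & W `<=` comb t.
Proof.
move=> + + ; elim: s W => [|b s IHs] W hW Ws; first by exists [::].
have [W0 WD WM] := hW; have [C0 CD CM] := comb_subspace s.
have hWs : right_subspace K (W `&` comb s).
  split=> [//|u v [Wu su] [Wv sv]|u k [Wu su] Kk]; split.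
  - exact: WD.
  - exact: CD.
  - exact: WM.
  - exact: CM.
have [t tW Wt] := IHs _ hWs (@subIsetr _ _ _).
case: (pselect (W `<=` comb s)) => [sWs|/existsNP[w /not_implyP[Ww sw]]].
  by exists t => x; [move/tW; case | move=> Wx; apply: Wt; split=> //; exact: sWs].
exists (w :: t) => x /=; first by rewrite inE => /orP[/eqP->//|/tW[]].
move=> Wx; have [k Kk hk] := Ws _ Ww; have [l Kl hl] := Ws _ Wx.
have k0 : k != 0 by apply/eqP => k0; apply: sw; rewrite k0 mulr0 subr0 in hk.
(* With this multiple of [w] subtracted, the coefficient of [x] at [b] vanishes. *)
exists (k^-1 * l); first by apply: KM => //; exact: KV.
have Kc : K (- (k^-1 * l)) by apply/KN/KM => //; exact: KV.
apply: Wt; rewrite -mulrN; split; first by apply: WD => //; apply: WM.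
have -> : x + w * - (k^-1 * l) = x - b * l + (w - b * k) * - (k^-1 * l).
  by rewrite mulrDl mulrNN -[b * k * _]mulrA mulVKr ?divF // addrACA addNr addr0.
by apply: CD => //; apply: CM.
Qed.

(** This reduces closures of possibly infinite [B] to the finite lists treated by density: finitely
    many vectors generate the span, and each involves finitely many elements of [B]. *)
Lemma right_span_finite_generated (V B : set F) : right_findim K V -> B `<=` V ->
  exists2 s, [set` s] `<=` B & right_span K B = comb s.
Proof.
move=> [hV [C /finite_seqP[s ->] [_ _ sV]]] BV.
have [|t tB Bt] := @comb_subspace_generated s _ (right_span_subspace B).
  by rewrite -right_span_comb sV; apply: right_span_sub.
suff [u uB tu] : exists2 u, [set` u] `<=` B & [set` t] `<=` comb u.
  exists u => //; apply/seteqP; split.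
    by move=> x /Bt; apply: comb_sub tu _; exact: comb_subspace.
  by move=> x hx; apply/right_spanP; exists u.
elim: t tB {Bt} => [|b t IHt] tB; first by exists [::].
have [|u uB tu] := IHt; first by move=> x /= xt; apply: tB; rewrite /= inE xt orbT.
have /right_spanP[v vB hv] := tB b (mem_head _ _).
exists (u ++ v) => x /=; first by rewrite mem_cat => /orP[/uB|/vB].
rewrite inE => /orP[/eqP->|/tu hx].
  by apply: combS hv => y yv; rewrite mem_cat yv orbT.
by apply: combS hx => y yu; rewrite mem_cat yu.
Qed.

End RightSpanTheory.

(** * Module structures on F, density and the closure of finitely many conjugates *)

Section Evaluation.
Variables (F : unitRingType) (n : nat) (sigma : {rmorphism F -> 'M[F]_n}).
Variable delta : skew_derivation sigma.
Hypothesis divF : forall x : F, x != 0 -> x \is a GRing.unit.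
Implicit Types (a c e : 'cV[F]_n) (P Q : skpoly delta) (b k w : F).

Lemma DmapD a b k : Dmap delta a (b + k) = Dmap delta a b + Dmap delta a k.
Proof. by rewrite /Dmap rmorphD skew_derD mulmxDl addrACA. Qed.

(* Evaluation at [a], extended from its value at 1 to the module structure on F
   in which x_i acts as the i-th component of [Dmap delta a]. *)
Definition act a P (w : F) : F :=
  skact (fun i (v : F^o) => Dmap delta a v i 0 : F^o) P w.

Let XD a i (v w : F^o) : Dmap delta a (v + w) i 0 =
  Dmap delta a v i 0 + Dmap delta a w i 0.
Proof. by rewrite DmapD mxE. Qed.

Let XZ a i b (w : F^o) : Dmap delta a (b *: w) i 0 =
  \sum_j sigma b i j *: (Dmap delta a w j 0 : F^o) + delta b i 0 *: w.
Proof.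
rewrite /Dmap rmorphM skew_derM -mulmxA addrA -mulmxDr.
by rewrite mxE rscaleE mxE.
Qed.

Lemma act0 a w : act a 0 w = 0.
Proof. exact: (skact0 _ (w : F^o)). Qed.

Lemma actD a P Q w : act a (P + Q) w = act a P w + act a Q w.
Proof. exact: (skactD _ P Q (w : F^o)). Qed.

Lemma actZ a b P w : act a (b *: P) w = b * act a P w.
Proof. exact: (skactZ _ b P (w : F^o)). Qed.

Lemma actN a P w : act a (- P) w = - act a P w.
Proof. by rewrite -scaleN1r actZ mulN1r. Qed.

Lemma actM a P Q w : act a (P * Q) w = act a P (act a Q w).
Proof. exact: (skactM (XD a) (XZ a) P Q (w : F^o)). Qed.

Lemma actDr a P v w : act a P (v + w) = act a P v + act a P w.
Proof. exact: (skactDr (W := F^o) (XD a) P v w). Qed.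

Lemma act0r a P : act a P 0 = 0.
Proof. by apply: (addIr (act a P 0)); rewrite -actDr !add0r. Qed.

Lemma actNr a P w : act a P (- w) = - act a P w.
Proof. by apply/eqP; rewrite -addr_eq0 -actDr addNr act0r. Qed.

Lemma act1 a w : act a 1 w = w.
Proof. by rewrite /act skactU /= scale1r. Qed.

Lemma actC a b w : act a (skpolyC delta b) w = b * w.
Proof. by rewrite /act skactU. Qed.

Lemma actX a i w : act a (skpolyX delta i) w = Dmap delta a w i 0.
Proof. by rewrite /act skactU /= scale1r. Qed.

(* The right multiplications by these [k] are the module homomorphisms from F
   acted on through [a] to F acted on through [c]. *)
Definition intertwiner a c : set F := [set k | Dmap delta c k = rscale a k].

(** The definition of [intertwiner] is the case [b = 1]; the product rule of the derivation
    propagates it to all [b]. *)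
Lemma intertwinerE a c k b : intertwiner a c k ->
  Dmap delta c (b * k) = rscale (Dmap delta a b) k.
Proof.
rewrite /intertwiner /= /Dmap /rscale => ack.
by rewrite rmorphM skew_derM -mulmxA addrA -mulmxDr ack mulmxA -mulmxDl.
Qed.

Lemma act_intertwiner a c k P b : intertwiner a c k ->
  act c P (b * k) = act a P b * k.
Proof.
move=> ack; rewrite /act /skact /msum.
rewrite [RHS]mulr_suml; apply: eq_bigr => m _.
rewrite -[RHS]mulrA; congr (_ * _).
by elim: m => //= i m ->; rewrite (intertwinerE _ ack) rscaleE.
Qed.

Lemma intertwiner0 a c : intertwiner a c 0.
Proof.
rewrite /intertwiner /= /Dmap rmorph0 mul0mx add0r delta0.
by rewrite /rscale raddf0 mulmx0.
Qed.

Lemma intertwiner1 a : intertwiner a a 1.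
Proof.
by rewrite /intertwiner /= /Dmap rmorph1 mul1mx delta1 addr0 /rscale mulmx1.
Qed.

Lemma intertwinerB a c b k : intertwiner a c b -> intertwiner a c k ->
  intertwiner a c (b - k).
Proof.
rewrite /intertwiner /= => hb hk; apply: (addIr (Dmap delta c k)).
by rewrite -DmapD subrK hb hk -mulmxDr -raddfD subrK.
Qed.

Lemma intertwinerM a c e b k : intertwiner a c b -> intertwiner c e k ->
  intertwiner a e (b * k).
Proof.
move=> hb /intertwinerE hk; rewrite /intertwiner /= hk hb.
by rewrite /rscale -mulmxA -scalar_mxM.
Qed.

Lemma intertwinerV a c k : intertwiner a c k -> intertwiner c a k^-1.
Proof.
have [->|k0] := eqVneq k 0; first by rewrite invr0 => _; exact: intertwiner0.
(* At [k^-1] the intertwining identity has [Dmap delta c 1], which is [c], on its left. *)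
move=> /(intertwinerE k^-1); rewrite mulVr ?divF // intertwiner1 /intertwiner /=.
rewrite /rscale mulmx1 => ->.
by rewrite -mulmxA -scalar_mxM divrr ?divF // mulmx1.
Qed.

Lemma centralizer_division_subring a : division_subring (centralizer delta a).
Proof.
split; [exact: intertwiner1 | exact: intertwinerB | exact: intertwinerM|].
exact: intertwinerV.
Qed.

(** The difference between P and its value lies in the left ideal generated by the x_i - a_i, and
    each of these kills 1 in the module at [a]. *)
Lemma skevalE P a : skeval P a = act a P 1.
Proof.
have [q hq] : is_skeval P a (skeval P a) by apply/skevalP.
apply/esym/eqP; rewrite -subr_eq0 -[X in _ - X]mulr1 -(actC a) -actN -actD hq.
rewrite (big_morph (act a ^~ 1) (fun P Q => actD a P Q 1) (act0 a 1)).
rewrite big1 // => i _; rewrite actM actD actN actX actC.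
have := intertwiner1 a; rewrite /intertwiner /= /rscale mulmx1 => ->.
by rewrite mulr1 subrr act0r.
Qed.

(* Jacobson density, for the two simple modules at [a] and [c] at once *)
Lemma act_density a c s w :
  (forall P, (forall b, b \in s -> act a P b = 0) -> act c P w = 0) ->
  comb (intertwiner a c) s w.
Proof.
elim: s w => [|b s IHs] w h /=; first by rewrite -[w](act1 c) h.
(* If every polynomial killing [s] also kills [b], then [b] is redundant and gets coefficient 0. *)
have [hb|/existsNP[P0 /not_implyP[P0s /eqP P0b]]] :=
    pselect (forall P, (forall x, x \in s -> act a P x = 0) -> act a P b = 0).
  exists 0; first exact: intertwiner0.
  rewrite mulr0 subr0; apply: IHs => P Ps.
  apply: h => x; rewrite inE => /orP[/eqP->|]; [exact: hb | exact: Ps].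
(* [P1] kills [s] and sends [b] to 1. Among polynomials killing [s], the action on [w] therefore
   depends only on the action on [b], and [act c P1 w] is the coefficient of [b]. *)
pose P1 := (act a P0 b)^-1 *: P0.
have P1b : act a P1 b = 1 by rewrite actZ mulVr ?divF.
have P1s x : x \in s -> act a P1 x = 0 by move=> /P0s e; rewrite actZ e mulr0.
have Pw P : (forall x, x \in s -> act a P x = 0) ->
    act c P w = act a P b * act c P1 w.
  move=> Ps; apply/eqP; rewrite -subr_eq0 -actZ -actN -actD; apply/eqP/h => x.
  rewrite inE actD actN actZ => /orP[/eqP->|xs]; first by rewrite P1b mulr1 subrr.
  by rewrite Ps // P1s // mulr0 subrr.
(* The product of x_i with [P1] still kills [s] and sends [b] to the i-th component of [a], so [Pw]
   yields the intertwining equation. *)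
have hd : intertwiner a c (act c P1 w).
  apply/matrixP => i j; rewrite ord1 -actX -actM Pw => [|x xs].
    rewrite actM P1b actX rscaleE; congr (_ * _).
    by have := intertwiner1 a; rewrite /intertwiner /= /rscale mulmx1 => ->.
  by rewrite actM P1s // act0r.
exists (act c P1 w) => //; apply: IHs => P Ps.
by rewrite actDr actNr (act_intertwiner _ _ hd) Pw // subrr.
Qed.

(** Conjugacy is isomorphism of modules: right multiplication by [b] carries the module at [c] to
    the module at [a]. *)
Lemma conjvP a b c : b != 0 -> conjv delta a b = c <-> intertwiner c a b.
Proof.
move=> b0; rewrite /conjv /intertwiner /=; split=> [<-|->].
  by rewrite /rscale -mulmxA -scalar_mxM mulVr ?divF // mulmx1.
by rewrite /rscale -mulmxA -scalar_mxM divrr ?divF // mulmx1.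
Qed.

Lemma conjv_eqP a b k : b != 0 -> k != 0 ->
  conjv delta a b = conjv delta a k <-> centralizer delta a (b^-1 * k).
Proof.
move=> b0 k0; have hk := (conjvP a (conjv delta a k) k0).1 erefl.
rewrite (conjvP a _ b0); split=> [/intertwinerV hb|hbk].
  exact: intertwinerM hb hk.
have /intertwinerV : intertwiner a a (b^-1 * k) := hbk.
move/(intertwinerM hk); rewrite invrM ?unitrV ?divF // invrK mulrA.
by rewrite divrr ?divF // mul1r.
Qed.

Lemma act_conjv a P b : b != 0 -> act a P b = skeval P (conjv delta a b) * b.
Proof.
move=> b0; rewrite skevalE -(act_intertwiner (a := conjv delta a b) (c := a)).
  by rewrite mul1r.
exact/conjvP.
Qed.

Lemma Pideal_conj a (B : set F) P : ~ B 0 ->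
  Pideal [set conjv delta a b | b in B] P <-> forall b, B b -> act a P b = 0.
Proof.
move=> B0; split=> hP b.
  have [-> //|b0] := eqVneq b 0; move=> Bb.
  by rewrite act_conjv // hP ?mul0r //; exists b.
case=> k Bk <-; have k0 : k != 0 by apply/eqP => k0; apply: B0; rewrite -k0.
by apply: (mulIr (divF k0)); rewrite -act_conjv // hP // mul0r.
Qed.

Lemma Pclosure_conj_seq a s : 0 \notin s ->
  Pclosure delta [set conjv delta a b | b in [set` s]] =
  conj_image delta a (comb (centralizer delta a) s).
Proof.
move=> s0; have B0 : ~ [set` s] 0 by apply/negP.
apply/seteqP; split=> [c hc|_ [g [sg /eqP g0] <-] P].
  have [g g0 gc] : exists2 g, g != 0 & conjv delta a g = c.
    have /(act_density (w := 1)) : forall P,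
        (forall b, b \in s -> act a P b = 0) -> act c P 1 = 0.
      by move=> P hP; rewrite -skevalE; apply/hc/(Pideal_conj _ _ B0).
    have : 1 != 0 :> F := oner_neq0 F.
    elim: s 1 {s0 B0 hc} => [|b s IHs] w w0 /=; first by move=> /eqP; rewrite (negPf w0).
    case=> k hk hs; have [k0|k0] := eqVneq k 0.
      by apply: (IHs w) => //; rewrite k0 mulr0 subr0 in hs.
    exists k^-1; first by rewrite invr_eq0.
    apply/conjvP; rewrite ?invr_eq0 //; exact: intertwinerV.
  exists g => //; split; last exact/eqP.
  apply: (@act_density a a) => P /(Pideal_conj a P B0) hP.
  by rewrite act_conjv // gc hc // mul0r.
move=> /(Pideal_conj a P B0) hP; apply: (mulIr (divF g0)).
rewrite -act_conjv // mul0r; elim: s g {g0 B0 s0} sg hP => [|b s IHs] g /=.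
  by move=> -> _; rewrite act0r.
case=> k hk hg hP; rewrite -(subrK (b * k) g) actDr.
rewrite (act_intertwiner _ _ hk) (hP b (mem_head _ _)) mul0r addr0.
by apply: IHs => // x xs; apply: hP; rewrite inE xs orbT.
Qed.

End Evaluation.

Section ConjugacyClass.
Variables (F : unitRingType) (n : nat) (sigma : {rmorphism F -> 'M[F]_n}).
Variables (delta : skew_derivation sigma) (a : 'cV[F]_n).
Hypothesis divF : forall x : F, x != 0 -> x \is a GRing.unit.
Local Notation K := (centralizer delta a).
Local Notation conj := (conjv delta a).
Local Notation conj_image := (conj_image delta a).

Let KP : division_subring K. Proof. exact: centralizer_division_subring. Qed.

Lemma PclosureS (A B : set 'cV[F]_n) :
  A `<=` B -> Pclosure delta A `<=` Pclosure delta B.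
Proof. by move=> AB c hc P hP; apply: hc => b /AB; exact: hP. Qed.

Lemma sub_Pclosure (A : set 'cV[F]_n) : A `<=` Pclosure delta A.
Proof. by move=> c Ac P; apply. Qed.

Lemma PclosureK (A : set 'cV[F]_n) :
  Pclosure delta (Pclosure delta A) = Pclosure delta A.
Proof.
apply/seteqP; split; last exact: sub_Pclosure.
by move=> c hc P hP; apply: hc => b; apply.
Qed.

Lemma sub_neq0 (V B : set F) : ~ B 0 -> B `<=` V -> B `<=` V `\ 0.
Proof. by move=> B0 BV b Bb; split=> [|/= b0]; [exact: BV | apply: B0; rewrite -b0]. Qed.

Lemma conj_image_conjv (V : set F) b : right_subspace K V -> b != 0 ->
  conj_image V (conj b) <-> V b.
Proof.
move=> [_ _ VM] b0; split=> [[k [Vk /eqP k0]]|Vb].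
  move=> /(conjv_eqP delta divF a k0 b0) hk.
  by rewrite -(mulVKr (divF k0) b); apply: VM.
by exists b => //; split=> //; apply/eqP.
Qed.

Lemma conj_image_sub (V W : set F) : right_subspace K V -> right_subspace K W ->
  conj_image V `<=` conj_image W -> V `<=` W.
Proof.
move=> hV hW VW b Vb; have [->|b0] := eqVneq b 0; first by case: hW.
by apply/(conj_image_conjv hW b0)/VW/conj_image_conjv.
Qed.

Lemma conj_image_inj (V W : set F) : right_subspace K V -> right_subspace K W ->
  conj_image V = conj_image W -> V = W.
Proof.
by move=> hV hW e; apply/seteqP; split; apply: conj_image_sub; rewrite // e.
Qed.

Lemma conj_image_lift (V : set F) (A : set 'cV[F]_n) : A `<=` conj_image V ->
  exists B : set F, [/\ B `<=` V `\ 0, [set conj b | b in B] = A & set_inj B conj].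
Proof.
move=> AV; have /choice[g gP] c : exists b, A c -> (V `\ 0) b /\ conj b = c.
  by case: (pselect (A c)) => [/AV[b Vb bc]|nAc]; [exists b | exists 0].
have gK c : A c -> conj (g c) = c by move=> /gP[].
exists [set g c | c in A]; split.
- by move=> _ [c /gP[Vgc _] <-].
- apply/seteqP; split=> [_ [_ [c Ac <-] <-]|c Ac]; first by rewrite gK.
  by exists (g c); [exists c | exact: gK].
- by move=> _ _ /set_mem[x Ax <-] /set_mem[y Ay <-]; rewrite !gK // => ->.
Qed.

Lemma Pclosure_conj (V B : set F) : right_findim K V -> B `<=` V -> ~ B 0 ->
  Pclosure delta [set conj b | b in B] = conj_image (right_span K B).
Proof.
move=> hV BV B0; have [s sB eB] := right_span_finite_generated divF KP hV BV.
have s0 : 0 \notin s by apply/negP => /sB.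
rewrite eB -Pclosure_conj_seq //; apply/seteqP; split.
  rewrite -[X in _ `<=` X]PclosureK; apply: PclosureS.
  rewrite Pclosure_conj_seq // -eB => _ [b Bb <-].
  by exists b => //; apply: sub_neq0 Bb => //; exact: sub_right_span.
by apply: PclosureS; apply: image_subset.
Qed.

Lemma right_basis_neq0 (V B : set F) : right_basis K V B -> ~ B 0.
Proof.
case=> _ /(right_freeP divF KP) freeB _ /freeB; apply.
by case: (right_span_subspace KP (B `\ 0)).
Qed.

Lemma conj_image_Pclosed (V : set F) : right_findim K V ->
  Pclosed delta (conj_image V) /\ Pfingen delta (conj_image V).
Proof.
move=> hV; have [_ [B finB basB]] := hV.
have B0 := right_basis_neq0 basB; have [BV _ spanB] := basB.
have eV : Pclosure delta [set conj b | b in B] = conj_image V.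
  by rewrite (Pclosure_conj hV) // spanB.
split; first by rewrite /Pclosed -eV PclosureK.
exists [set conj b | b in B]; first exact: finite_image.
by split=> //; apply: image_subset; apply: sub_neq0.
Qed.

Lemma conj_image_class (V : set F) : conj_image V `<=` conj_class delta a.
Proof. by apply: image_subset => b []. Qed.

Lemma Pclosure_finite (G : set 'cV[F]_n) :
  G `<=` conj_class delta a -> finite_set G ->
  exists2 V, right_findim K V & Pclosure delta G = conj_image V.
Proof.
move=> /conj_image_lift[B [BV <- injB]].
rewrite (eq_finite_set (inj_card_eq injB)) => finB.
have hB : right_findim K (right_span K B) by exact: right_findim_span.
exists (right_span K B) => //; apply: Pclosure_conj hB _ _.
  exact: sub_right_span.
by move=> /BV[_]; apply.
Qed.

Lemma right_basis_Pbasis (V B : set F) : right_findim K V -> ~ B 0 ->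
  right_basis K V B <->
  Pbasis delta (conj_image V) [set conj b | b in B] /\ set_inj B conj.
Proof.
move=> hV B0; have [hVs _] := hV.
have nz b : B b -> b != 0 by move=> Bb; apply/eqP => b0; apply: B0; rewrite -b0.
have closureD b : B `<=` V -> Pclosure delta [set conj x | x in B `\ b] =
    conj_image (right_span K (B `\ b)).
  by move=> BV; rewrite (Pclosure_conj hV) // => [x [/BV]|[]].
have spanD b := right_span_subspace KP (B `\ b).
split=> [[BV /(right_freeP divF KP) freeB spanB]|].
  have injB : set_inj B conj.
    move=> b c /set_mem Bb /set_mem Bc; have b0 := nz _ Bb.
    move/(conjv_eqP delta divF a b0 (nz _ Bc)) => Kbc.
    apply: contrapT => bc; apply: (freeB c Bc).
    have [_ _ SM] := spanD c; rewrite -[X in right_span _ _ X](mulVKr (divF b0)).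
    by apply: SM => //; apply: sub_right_span.
  split=> //; split; last split.
  - move=> _ [b Bb <-] hb; apply: (freeB b Bb).
    apply/(conj_image_conjv (spanD b) (nz _ Bb)).
    rewrite -closureD //; apply: PclosureS hb => _ [[c Bc <-] cb].
    by exists c => //; split=> // /= ecb; apply: cb; rewrite ecb.
  - by apply: image_subset; apply: sub_neq0.
  - by rewrite (Pclosure_conj hV) // spanB.
move=> [[indB [BO genB]] injB].
have BV : B `<=` V.
  move=> b Bb; apply/(conj_image_conjv hVs (nz _ Bb))/BO.
  by exists b.
split=> //.
  apply/(right_freeP divF KP) => b Bb hb; apply: (indB (conj b)); first by exists b.
  have : conj_image (right_span K (B `\ b)) (conj b).
    exact/(conj_image_conjv (spanD b) (nz _ Bb)).
  rewrite -closureD //; apply: PclosureS => _ [c [Bc cb] <-].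
  split; first by exists c.
  by move=> /= /injB e; apply: cb; apply: e; exact: mem_set.
apply: conj_image_inj => //; first exact: right_span_subspace.
by rewrite -(Pclosure_conj hV).
Qed.

Lemma Prank_conj_image (V : set F) : right_findim K V ->
  Prank delta (conj_image V) = right_dim K V.
Proof.
move=> hV; rewrite /Prank /right_dim; congr (xget _ _).
apply/seteqP; split=> d /= [B basB cardB].
  have [_ [BO _]] := basB; have [D [DV eB injD]] := conj_image_lift BO.
  exists D.
    by apply/right_basis_Pbasis => //; [move=> /DV[_]; apply | rewrite eB].
  by apply: card_eq_trans cardB; rewrite -eB card_eq_sym inj_card_eq.
have B0 := right_basis_neq0 basB.
have [basO injB] := (right_basis_Pbasis hV B0).1 basB.
exists [set conj b | b in B] => //.
exact: card_eq_trans (inj_card_eq injB) cardB.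
Qed.

Definition conj_linearization (A : set 'cV[F]_n) : set F :=
  [set b | b = 0 \/ A (conj b)].

Lemma conj_imageK (V : set F) : right_subspace K V ->
  conj_linearization (conj_image V) = V.
Proof.
move=> hV; apply/seteqP; split=> b.
  case=> [->|hb]; first by case: hV.
  have [->|b0] := eqVneq b 0; first by case: hV.
  exact/(conj_image_conjv hV b0).
have [->|b0] := eqVneq b 0; first by left.
by move=> Vb; right; apply/conj_image_conjv.
Qed.

Lemma conj_linearizationP (A : set 'cV[F]_n) : Pfingen delta A ->
  A `<=` conj_class delta a ->
  right_findim K (conj_linearization A) /\
    conj_image (conj_linearization A) = A.
Proof.
move=> [G finG [GA <-]] AsubC.
have [|V hV ->] := Pclosure_finite _ finG; last first.
  by rewrite conj_imageK //; case: hV.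
exact: subset_trans (@sub_Pclosure G) AsubC.
Qed.

End ConjugacyClass.

Theorem theorem4 (F : unitRingType)
    (divF : forall x : F, x != 0 -> x \is a GRing.unit)
    (n : nat) (n_gt0 : (0 < n)%N)
    (sigma : {rmorphism F -> 'M[F]_n}) (delta : skew_derivation sigma)
    (a : 'cV[F]_n) :
  [/\ (* item 1 *)
      forall G : set 'cV[F]_n,
        G `<=` conj_class delta a -> finite_set G ->
        exists V : set F,
          [/\ right_findim (centralizer delta a) V,
              Pclosure delta G = conj_image delta a V
            & Pclosure delta G `<=` conj_class delta a],
      (* item 2 *)
      forall V : set F,
        right_findim (centralizer delta a) V ->
        [/\ conj_image delta a V `<=` conj_class delta a,
            Pclosed delta (conj_image delta a V)
          & Pfingen delta (conj_image delta a V)],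
      (* bases and rank *)
      forall (Omega : set 'cV[F]_n) (V : set F),
        right_findim (centralizer delta a) V ->
        Omega = conj_image delta a V ->
        (forall BD : set F, ~ BD 0 ->
           (right_basis (centralizer delta a) V BD <->
            Pbasis delta Omega [set conjv delta a b | b in BD] /\
            set_inj BD (conjv delta a)))
        /\ Prank delta Omega = right_dim (centralizer delta a) V
    & (* the bijection Omega |-> Omega^D, determined by the equation of item 1 *)
      exists lin : set 'cV[F]_n -> set F,
        (forall (Omega : set 'cV[F]_n) (V : set F),
           Pclosed delta Omega -> Pfingen delta Omega ->
           Omega `<=` conj_class delta a ->
           right_findim (centralizer delta a) V ->
           (V = lin Omega <-> Omega = conj_image delta a V))
        /\ set_bij
             [set Omega | [/\ Pclosed delta Omega, Pfingen delta Omega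
                            & Omega `<=` conj_class delta a]]
             [set V | right_findim (centralizer delta a) V]
             lin].
Proof.
split.
- move=> G GC finG; have [V hV eV] := Pclosure_finite divF GC finG.
  by exists V; split=> //; rewrite eV; exact: conj_image_class.
- move=> V hV; have [closedV fgV] := conj_image_Pclosed divF hV.
  by split=> //; exact: conj_image_class.
- move=> _ V hV ->; split; last exact: Prank_conj_image.
  by move=> B; exact: right_basis_Pbasis.
exists (conj_linearization delta a); split.
  move=> A V _ fgA AsubC [hV _].
  have [_ eA] := conj_linearizationP divF fgA AsubC.
  by split=> [->|->]; rewrite ?eA ?conj_imageK.
split.
- move=> A [_ fgA AsubC].
  by case: (conj_linearizationP divF fgA AsubC).
- move=> A B /set_mem[_ fgA AsubC] /set_mem[_ fgB BsubC] e.
  have [_ <-] := conj_linearizationP divF fgA AsubC.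
  by rewrite e; case: (conj_linearizationP divF fgB BsubC).
- move=> V hV; have [closedV fgV] := conj_image_Pclosed divF hV.
  exists (conj_image delta a V); last by apply: conj_imageK => //; case: hV.
  by split=> //; exact: conj_image_class.
Qed.
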